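(* Let $r\in\mathbb{N}$ and let $\mu_1,\ldots,\mu_r$ be complex measures, with supports $\Gamma_1,\ldots,\Gamma_r$, all of whose moments exist. Assume that they form a weakly complete system. Let $n\in\mathbb{N}$ and assume that the monic type II multiple orthogonal polynomial $P_n$ has simple zeros $x_{1,n},\ldots,x_{n,n}$. Let $L_n$ be the $n\times n$ banded lower Hessenberg matrix of recurrence coefficients; its eigenvalues are $x_{1,n},\ldots,x_{n,n}$. For $\ell=1,\ldots,n$ let $\vec v_{\ell,n}$ be the right eigenvector of $L_n$ for the eigenvalue $x_{\ell,n}$ ($L_n\vec v_{\ell,n}=x_{\ell,n}\vec v_{\ell,n}$) with first component equal to $1$. Let $\vec u_{\ell,n}$ be the corresponding left eigenvector ($\vec u_{\ell,n}^{\,T}L_n=x_{\ell,n}\vec u_{\ell,n}^{\,T}$), normalized so that its first non-zero component, the $k_\ell$th one, is equal to $1$; here $1\le k_\ell\le\min(r,n)$. Let $w^{(j)}_{\ell,n}$ be the weights of multiple Gaussian quadrature. Then, for $\ell=1,\ldots,n$, $$w^{(j)}_{\ell,n}=\frac{1}{\vec u_{\ell,n}^{\,T}\vec v_{\ell,n}}\left(\sum_{k=1}^{\min(j,n)}C_{j,k}\,\vec u_{\ell,n}(k)\right),\qquad j=1,\ldots,r,$$ where $\vec u_{\ell,n}(k)$ is the $k$th component of $\vec u_{\ell,n}$ and $$C_{j,k}=\int_{\Gamma_j}P_{k-1}(x)\,d\mu_j(x)=\sum_{i=1}^k(-1)^{k+i}\,m^{(j)}_{i-1}\,\frac{\det D_k^{(k,i)}}{\det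 D_{k-1}},\qquad 1\le k\le j\le r.$$ Moreover, the constants $C_{j,j}$, $j=1,\ldots,r$, are different from $0$, and $w^{(j)}_{\ell,n}=0$ for $j=1,\ldots,k_\ell-1$.
   Context: Notation: $\mathbb{N}=\{1,2,\ldots\}$, $\mathbb{N}_0=\mathbb{N}\cup\{0\}$. For $n\in\mathbb{N}_0$ write $n=mr+s$ with $0<s\le r$ ($m,s$ integers). The proper multi-index corresponding to $n$ is $\vec\nu_n=(m+1,\ldots,m+1,m,\ldots,m)\in\mathbb{N}_0^r$, with $s$ entries $m+1$ followed by $r-s$ entries $m$; $\vec\nu_n(j)$ is its $j$th component. Type II polynomials and normality: a type II multiple orthogonal polynomial for $\vec\nu_n$ is a (nonzero) polynomial $P_n$ of degree at most $n$ with $\int_{\Gamma_j}P_n(x)x^\ell\,d\mu_j(x)=0$ for $\ell=0,\ldots,\vec\nu_n(j)-1$, $j=1,\ldots,r$. The multi-index $\vec\nu_n$ is normal if every such nonzero polynomial has exact degree $n$ (equivalently, the solution is unique up to a scalar factor and has exact degree $n$). The measures $\mu_1,\ldots,\mu_r$ form a weakly complete system if all $\vec\nu_n$, $n\in\mathbb{N}$, are normal. In that case $P_n$ denotes the unique monic type II polynomial ($P_0\equiv1$, and $P_j\equiv0$ for $j<0$). Recurrence and the matrix $L_n$: for a weakly complete system the $P_n$ satisfy a recurrence relation $$xP_n(x)=P_{n+1}(x)+\sum_{j=0}^{r}a_{n,j}P_{n-j}(x),\qquad n\ge0,$$ with uniquely determined recurrence coefficients $a_{n,j}\in\mathbb{C}$,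 $0\le j\le\min(r,n)$. The matrix $L_n$ is the $n\times n$ matrix, with rows and columns indexed by $0,\ldots,n-1$, whose entries are $(L_n)_{p,p+1}=1$ for $0\le p\le n-2$, $(L_n)_{p,p-j}=a_{p,j}$ for $0\le p\le n-1$ and $0\le j\le\min(r,p)$, and $0$ otherwise. In particular $P_n(x)=\det(xI_n-L_n)$. (Components of vectors are numbered $1,\ldots,n$.) Moments: $m^{(j)}_\ell=\int_{\Gamma_j}x^\ell\,d\mu_j(x)$. The $n\times n$ matrix $D_n$ is $\bigl(D^{(1)}_{n,\vec\nu_n(1)}\ \cdots\ D^{(r)}_{n,\vec\nu_n(r)}\bigr)^T$, where $D^{(j)}_{n,\ell}$ is the $n\times\ell$ matrix with $(p,q)$ entry $m^{(j)}_{p+q-2}$, $1\le p\le n$, $1\le q\le\ell$. $D_n^{(j,i)}$ is the matrix obtained from $D_n$ by deleting the $j$th row and the $i$th column. Conventions: $\det D_1^{(1,1)}=1$ and $\det D_0=1$. Multiple Gaussian quadrature: this is the set of $r$ quadrature formulas $\int_{\Gamma_j}f(x)\,d\mu_j(x)\approx\sum_{\ell=1}^n w^{(j)}_{\ell,n}f(x_{\ell,n})$, $j=1,\ldots,r$, whose common nodes $x_{1,n},\ldots,x_{n,n}$ are the (simple) zeros of $P_n$ and which are interpolating, i.e. $$w^{(j)}_{\ell,n}=\int_{\Gamma_j}\prod_{i=1,\,i\ne\ell}^n\frac{x-x_{i,n}}{x_{\ell,n}-x_{i,n}}\,d\mu_j(x),\qquad \ell=1,\ldots,n,\ j=1,\ldots,r.$$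 *)

(* Defs.v *)
From HB Require Import structures.
From mathcomp Require Import all_boot all_order all_algebra.
From mathcomp Require Import complex.
From mathcomp Require Import all_classical all_reals all_analysis.
Set Implicit Arguments.
Unset Strict Implicit.
Unset Printing Implicit Defensive.
Import Order.TTheory GRing.Theory Num.Theory.
Import numFieldNormedType.Exports.
Local Open Scope classical_set_scope.
Local Open Scope ring_scope.
Local Open Scope complex_scope.

(* R[i] carries its norm topology through the alias R[i]^o. *)
Definition borelC (R : realType) := g_sigma_algebraType (@open R[i]^o).

Section ChargeIntegral.
Context d (T : measurableType d) (R : realType).
Implicit Types (nu : {charge set T -> \bar R}) (D : set T) (f : T -> R).

Definition hahn_pos nu : set T := projT1 (cid (Hahn_decomposition nu)).

Definition hahn_neg nu : set T :=
  projT1 (cid (projT2 (cid (Hahn_decomposition nu)))).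

Lemma hahn_posneg nu : hahn_decomposition nu (hahn_pos nu) (hahn_neg nu).
Proof. exact: projT2 (cid (projT2 (cid (Hahn_decomposition nu)))). Qed.

(* The Jordan decomposition does not depend on the chosen Hahn decomposition. *)
Definition charge_integrable nu D f : Prop :=
  (jordan_pos (hahn_posneg nu)).-integrable D (EFin \o f) /\
  (jordan_neg (hahn_posneg nu)).-integrable D (EFin \o f).

Definition charge_integral nu D f : R :=
  Rintegral (jordan_pos (hahn_posneg nu)) D f -
  Rintegral (jordan_neg (hahn_posneg nu)) D f.

End ChargeIntegral.

Record complex_measure (R : realType) := ComplexMeasure {
  cm_re : {charge set borelC R -> \bar R};
  cm_im : {charge set borelC R -> \bar R} }.

Section ComplexMeasure.
Variable R : realType.
Implicit Types (mu : complex_measure R) (f : R[i] -> R[i]).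

Definition cm_value mu (A : set (borelC R)) : R[i] :=
  fine (cm_re mu A) +i* fine (cm_im mu A).

(* Support of the total variation: a Borel set is |mu|-null if and only if
   mu vanishes on all of its Borel subsets. *)
Definition csupport mu : set (borelC R) :=
  [set z | forall U : set (R[i]^o), open U -> U z ->
     exists A : set (borelC R),
       [/\ measurable A, A `<=` U & cm_value mu A != 0]].

Definition cintegrable mu f : Prop :=
  [/\ charge_integrable (cm_re mu) (csupport mu) (fun z => complex.Re (f z)),
      charge_integrable (cm_re mu) (csupport mu) (fun z => complex.Im (f z)),
      charge_integrable (cm_im mu) (csupport mu) (fun z => complex.Re (f z)) &
      charge_integrable (cm_im mu) (csupport mu) (fun z => complex.Im (f z))].

Definition cintegral mu f : R[i] :=
  (charge_integral (cm_re mu) (csupport mu) (fun z => complex.Re (f z)) -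
   charge_integral (cm_im mu) (csupport mu) (fun z => complex.Im (f z))) +i*
  (charge_integral (cm_re mu) (csupport mu) (fun z => complex.Im (f z)) +
   charge_integral (cm_im mu) (csupport mu) (fun z => complex.Re (f z))).

Definition moment mu (l : nat) : R[i] := cintegral mu (fun z => z ^+ l).

Definition all_moments_exist mu : Prop :=
  forall l : nat, cintegrable mu (fun z => z ^+ l).

End ComplexMeasure.

(* j counts from 0; see nuP for the decomposition n = m r + s, 0 < s <= r. *)
Definition nu (r n j : nat) : nat :=
  if n is n'.+1 then (n' %/ r + (j <= n' %% r))%N else 0%N.

Lemma nuP (r n : nat) (m s : int) (j : 'I_r) :
  n%:Z = m * r%:Z + s -> 0 < s -> s <= r%:Z ->
  (nu r n j)%:Z = m + (j%:Z < s)%R%:Z.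
Proof.
move: (ltn_ord j) => + nE s0 sr; set jj := nat_of_ord j => jr.
have r0 : (0 < r)%N by exact: leq_ltn_trans jr.
case: s s0 sr nE => // -[//|s] _; rewrite lez_nat ltz_nat ltnS => sr.
case: m => m nE; last first.
  have {nE} : (n + m.+1 * r = s.+1)%N.
    by apply/eqP; rewrite -eqz_nat PoszD PoszM nE NegzE mulNr addrAC addNr add0r.
  rewrite mulSn => nE; have nm0 : (n + m * r = 0)%N.
    have : (n + m * r + r <= 0 + r)%N by rewrite add0n addnAC -addnA nE.
    by rewrite leq_add2r leqn0 => /eqP.
  move: nE nm0; case: n => // nE; rewrite add0n => mr0.
  have m0 : m = 0%N by move/eqP: mr0; rewrite muln_eq0 (gtn_eqF r0) orbF => /eqP.
  by move: nE; rewrite m0 mul0n addn0 add0n => rE; rewrite /= -ltnS -rE jr.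
have {nE} -> : n = (m * r + s).+1.
  by apply/eqP; rewrite -eqz_nat nE -addnS PoszD PoszM.
by rewrite /= divnMDl// modnMDl modn_small// divn_small// addn0 PoszD.
Qed.

Lemma sum_nu (r n : nat) : (0 < r)%N -> (\sum_(j < r) nu r n j = n)%N.
Proof.
move=> r0; case: n => [|n] /=; first by rewrite big1.
rewrite big_split /= sum_nat_const card_ord.
rewrite [in RHS](divn_eq n r) mulnC -addnS; congr addn.
rewrite -(big_mkord xpredT (fun j => nat_of_bool (j <= n %% r)%N)).
have h : ((n %% r).+1 <= r)%N by rewrite ltn_mod.
rewrite (big_cat_nat (leq0n _) h) /=.
have -> : (\sum_((n %% r).+1 <= j < r) (j <= n %% r) = 0)%N.
  by rewrite big_nat big1// => i /andP [ni _]; rewrite leqNgt ni.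
rewrite addn0 -[RHS]subn0 -[RHS]muln1 -sum_nat_const_nat.
by apply: eq_big_nat => i; rewrite ltnS => /andP [_ ->].
Qed.

Section TypeII.
Variables (R : realType) (r : nat) (mu : 'I_r -> complex_measure R).

Definition typeII (n : nat) (p : {poly R[i]}) : Prop :=
  [/\ p != 0, (size p <= n.+1)%N &
      forall (j : 'I_r) (l : nat), (l < nu r n j)%N ->
        cintegral (mu j) (fun z => p.[z] * z ^+ l) = 0].

Definition normal_index (n : nat) : Prop :=
  forall p : {poly R[i]}, typeII n p -> size p = n.+1.

Definition weakly_complete : Prop :=
  forall n : nat, (0 < n)%N -> normal_index n.

(* Well defined for a weakly complete system: P_n exists and is unique. *)
Definition Ppoly (n : nat) : {poly R[i]} :=
  xget 0 [set p | typeII n p /\ p \is monic].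

(* n |-> (a_{n,0}, ..., a_{n,min(r,n)}); only these values are ever used. *)
Definition rec_coef (n : nat) : nat -> R[i] :=
  xget (fun=> 0) [set a : nat -> R[i] |
    'X * Ppoly n =
    Ppoly n.+1 + \sum_(j < (minn r n).+1) a j *: Ppoly (n - j)].

Definition Lmx (n : nat) : 'M[R[i]]_n :=
  \matrix_(p < n, q < n)
    if q == p.+1 :> nat then 1
    else if (q <= p)%N && (p - q <= r)%N then rec_coef p (p - q) else 0.

Definition Dblock (n l : nat) (j : 'I_r) : 'M[R[i]]_(n, l) :=
  \matrix_(p < n, q < l) moment (mu j) (p + q).

Definition Dmx (hr : (0 < r)%N) (n : nat) : 'M[R[i]]_n :=
  (castmx (erefl n, sum_nu n hr)
     (\mxrow_(j < r) Dblock n (nu r n j) j))^T.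

(* C_{j,k} of the paper, with j and k both counted from 0. *)
Definition Cconst (j : 'I_r) (k : nat) : R[i] :=
  cintegral (mu j) (fun z => (Ppoly k).[z]).

Definition weight (n : nat) (x : 'I_n -> R[i]) (j : 'I_r) (l : 'I_n) : R[i] :=
  cintegral (mu j)
    (fun z => \prod_(i < n | i != l) ((z - x i) / (x l - x i))).

End TypeII.

Section Eigenvectors.
Variables (F : fieldType) (n : nat).

Definition right_eigenvector (hn : (0 < n)%N) (L : 'M[F]_n) (z : F)
    (v : 'cV[F]_n) : Prop :=
  L *m v = z *: v /\ v (Ordinal hn) ord0 = 1.

Definition left_eigenvector (L : 'M[F]_n) (z : F) (u : 'cV[F]_n)
    (k : 'I_n) : Prop :=
  [/\ u^T *m L = z *: u^T, u k ord0 = 1 &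
      forall i : 'I_n, (i < k)%N -> u i ord0 = 0].

End Eigenvectors.

(* Main.v *)
Require Import Defs.
From HB Require Import structures.
From mathcomp Require Import all_boot all_order all_algebra.
From mathcomp Require Import complex ring.
From mathcomp Require Import all_classical all_reals all_analysis.
Set Implicit Arguments.
Unset Strict Implicit.
Unset Printing Implicit Defensive.
Import Order.TTheory GRing.Theory Num.Theory.
Import numFieldNormedType.Exports.
Local Open Scope classical_set_scope.
Local Open Scope ring_scope.
Local Open Scope complex_scope.

(* Order the orthogonality conditions along the step-line: the k-th one (k >= 0)
   is phi_k(p) = \int p(z) z^l d mu_j with k = l r + j and j < r. The type II
   polynomial for n kills phi_0, ..., phi_{n-1}, normality gives
   phi_n(P_n) != 0, and phi_k(z p) = phi_{k+r}(p). These facts yield the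
   recurrence, a_{n,r} != 0, C_{j,j} != 0 and C_{j,k} = 0 for k > j.

   The right eigenvector of L_n for x_l is (P_i(x_l))_i. If u is a left
   eigenvector for x_l, then sum_i u_i P_i vanishes at all other nodes, hence
   equals (u^T v) times the l-th Lagrange polynomial; integrating this identity
   against mu_j gives the formula for the weights. Column k - r of
   u^T L_n = x_l u^T reads u_k a_{k,r} = 0 if the first nonzero component had
   an index k >= r (from 0), so this index is below r. *)

(** * Monic bases, Lagrange polynomials and step-line orthogonality *)

Section MonicBasis.
Variables (F : fieldType) (P : nat -> {poly F}).
Hypotheses (P_monic : forall n, P n \is monic)
           (P_size : forall n, size (P n) = n.+1).

(** Subtracting the top coefficient times [P n] lowers the size. The coefficients form a function on
    all of [nat], so that they can be reindexed by [n - j] in the recurrence. *)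
Lemma monic_basis_expansion n (p : {poly F}) : (size p <= n)%N ->
  exists b : nat -> F, p = \sum_(i < n) b i *: P i.
Proof.
elim: n p => [|n IHn] p.
  rewrite leqn0 size_poly_eq0 => /eqP ->.
  by exists (fun=> 0); rewrite big_ord0.
move=> sp; have [|b bE] := IHn (p - p`_n *: P n).
  apply/leq_sizeP => i; rewrite leq_eqVlt => /orP[/eqP <-|ni].
    have /monicP := P_monic n; rewrite lead_coefE P_size /= => Pn1.
    by rewrite coefB coefZ Pn1 mulr1 subrr.
  rewrite coefB coefZ (leq_sizeP _ _ sp i ni) (nth_default 0 (s := P n)) ?P_size//.
  by rewrite mulr0 subr0.
exists (fun i => if i == n then p`_n else b i).
rewrite big_ord_recr /= eqxx -[LHS](subrK (p`_n *: P n)) bE; congr +%R.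
by apply: eq_bigr => i _; rewrite ltn_eqF.
Qed.

Lemma monic_basis_free n (b : 'I_n -> F) :
  \sum_(i < n) b i *: P i = 0 -> forall i, b i = 0.
Proof.
elim: n b => [|n IHn] b; first by move=> _ [].
rewrite big_ord_recr /= => bP.
have bmax : b ord_max = 0.
  have := congr1 (fun p : {poly F} => p`_n) bP.
  rewrite coefD coef_sum coefZ coef0 big1 ?add0r => [|i _]; last first.
    by rewrite coefZ nth_default ?mulr0 ?P_size.
  by have /monicP := P_monic n; rewrite lead_coefE P_size /= => ->; rewrite mulr1.
move: bP; rewrite bmax scale0r addr0 => /IHn bw i.
have [ni|ni] := ltnP i n.
  by rewrite -(bw (Ordinal ni)); congr b; apply: val_inj.
rewrite -bmax; congr b; apply: val_inj => /=.
by apply/eqP; rewrite eqn_leq ni -ltnS ltn_ord.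
Qed.

Lemma size_monic_basis_sum n (b : 'I_n -> F) :
  (size (\sum_(i < n) b i *: P i)%R <= n)%N.
Proof.
apply: (leq_trans (size_sum _ _ _)); apply/bigmax_leqP => i _.
by rewrite (leq_trans (size_scale_leq _ _))// P_size.
Qed.

End MonicBasis.

Section Lagrange.
Variables (F : fieldType) (n : nat) (x : 'I_n -> F).
Hypothesis x_inj : injective x.

Lemma poly_eq_on_nodes (p q : {poly F}) : (size p <= n)%N -> (size q <= n)%N ->
  (forall i, p.[x i] = q.[x i]) -> p = q.
Proof.
move=> sp sq pq; apply/eqP; rewrite -subr_eq0; apply/eqP.
apply: (@roots_geq_poly_eq0 _ _ [seq x i | i <- enum 'I_n]).
- by apply/allP => _ /mapP[i _ ->]; rewrite rootE !hornerE pq subrr.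
- by rewrite map_inj_uniq ?enum_uniq.
- rewrite size_map size_enum_ord (leq_trans (size_polyD _ _))//.
  by rewrite size_polyN geq_max sp.
Qed.

Definition lagrange_poly (l : 'I_n) : {poly F} :=
  \prod_(i < n | i != l) ((x l - x i)^-1 *: ('X - (x i)%:P)).

Lemma lagrange_polyE l z :
  (lagrange_poly l).[z] = \prod_(i < n | i != l) ((z - x i) / (x l - x i)).
Proof.
rewrite horner_prod; apply: eq_bigr => i _.
by rewrite hornerZ hornerXsubC mulrC.
Qed.

Lemma lagrange_poly_node l m : (lagrange_poly l).[x m] = (m == l)%:R.
Proof.
rewrite lagrange_polyE; case: eqVneq => [->|ml].
  by rewrite big1// => i il; rewrite divff// subr_eq0 (inj_eq x_inj) eq_sym.
by rewrite (bigD1 m)//= subrr !mul0r.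
Qed.

Lemma size_lagrange_poly l : (size (lagrange_poly l) <= n)%N.
Proof.
rewrite size_prod => [|i il]; last first.
  rewrite scaler_eq0 invr_eq0 subr_eq0 (inj_eq x_inj) eq_sym (negPf il).
  by rewrite polyXsubC_eq0.
rewrite (eq_bigr (fun=> 2%N)) => [|i il]; last first.
  by rewrite size_scale ?size_XsubC// invr_eq0 subr_eq0 (inj_eq x_inj) eq_sym.
rewrite sum_nat_const; have -> : #|[pred i | i != l]| = n.-1.
  by rewrite -[n in RHS]card_ord (cardC1 l).
have : (0 < n)%N by apply: leq_ltn_trans (ltn_ord l).
by case: (n) => // m _; rewrite muln2 -addnn -addnS addKn.
Qed.

End Lagrange.

(** [eigenvalue] is defined through row vectors; transposition gives access to right
    eigenvectors. *)
Lemma eigenvalue_trmx (F : fieldType) n (A : 'M[F]_n) z :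
  eigenvalue A^T z = eigenvalue A z.
Proof.
rewrite /eigenvalue /eigenspace !kermx_eq0 /row_free -[in RHS]mxrank_tr.
by rewrite linearB /= tr_scalar_mx.
Qed.

(** * Polynomials orthogonal along the step-line *)

Section StepLine.
Variables (F : fieldType) (r : nat) (phi : nat -> {scalar {poly F}}).

Definition step_orthogonal n (p : {poly F}) :=
  forall k, (k < n)%N -> phi k p = 0.

Hypothesis phi_shift : forall k (p : {poly F}), phi k ('X * p) = phi (k + r)%N p.
Hypothesis phi_normal : forall n (p : {poly F}),
  p != 0 -> (size p <= n.+1)%N -> step_orthogonal n p -> size p = n.+1.

(** These are [n] linear conditions on [n.+1] coefficients. *)
Lemma step_orthogonal_exists n : exists p : {poly F},
  [/\ p != 0, (size p <= n.+1)%N & step_orthogonal n p].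
Proof.
pose A : 'M[F]_(n.+1, n) := \matrix_(i, k) phi k 'X^i.
have : kermx A != 0.
  by rewrite kermx_eq0 /row_free neq_ltn ltnS rank_leq_col.
case/rowV0Pn => u /sub_kermxP uA u0.
pose p := \sum_(i < n.+1) u 0 i *: 'X^i.
have pE (i : 'I_n.+1) : p`_i = u 0 i.
  rewrite coef_sum (bigD1 i)//= coefZ coefXn eqxx mulr1 big1 ?addr0// => j ji.
  by rewrite coefZ coefXn [_ == _]eq_sym (inj_eq val_inj) (negPf ji) mulr0.
exists p; split.
- apply: contraNneq u0 => p0; apply/eqP/rowP => i.
  by rewrite -pE p0 coef0 mxE.
- apply: (leq_trans (size_sum _ _ _)); apply/bigmax_leqP => i _.
  by rewrite (leq_trans (size_scale_leq _ _))// size_polyXn ltnS leq_ord.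
- move=> k kn; rewrite linear_sum /=.
  have /matrixP/(_ 0 (Ordinal kn)) := uA; rewrite !mxE => uAk.
  rewrite -[RHS]uAk.
  by apply: eq_bigr => i _; rewrite linearZ mxE.
Qed.

Lemma monic_step_orthogonal_exists n : exists p : {poly F},
  [/\ p \is monic, size p = n.+1 & step_orthogonal n p].
Proof.
have [p [p0 sp op]] := step_orthogonal_exists n.
have lp0 : lead_coef p != 0 by rewrite lead_coef_eq0.
exists ((lead_coef p)^-1 *: p); split.
- by rewrite monicE lead_coefZ mulVf.
- by rewrite size_scale ?invr_eq0//; exact: phi_normal.
- by move=> k kn; rewrite linearZ /= op// mulr0.
Qed.

Variable P : nat -> {poly F}.
Hypotheses (P_monic : forall n, P n \is monic)
           (P_size : forall n, size (P n) = n.+1)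
           (P_orth : forall n, step_orthogonal n (P n)).

(** Otherwise [P n] would satisfy one condition more, and normality at [n.+1] would force its size
    to be [n.+2]. *)
Lemma step_orthogonal_diag n : phi n (P n) != 0.
Proof.
apply/eqP => Pn0.
have : size (P n) = n.+2.
  apply: phi_normal; rewrite ?monic_neq0 ?P_size//.
  by move=> k; rewrite ltnS leq_eqVlt => /orP[/eqP ->|/P_orth].
by rewrite P_size => /eqP; rewrite eqSS ltn_eqF.
Qed.

Lemma step_recurrence n : exists a : nat -> F,
  'X * P n = P n.+1 + \sum_(j < (minn r n).+1) a j *: P (n - j)%N.
Proof.
have [|b bE] := monic_basis_expansion P_monic P_size (n := n.+1)
    (p := 'X * P n - P n.+1).
  have sXP : size ('X * P n) = n.+2.
    by rewrite mulrC size_mulX ?monic_neq0// P_size.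
  apply/leq_sizeP => i; rewrite leq_eqVlt => /orP[/eqP <-|ni].
    rewrite coefB mulrC coefMX /=.
    have /monicP := P_monic n; rewrite lead_coefE P_size /= => ->.
    have /monicP := P_monic n.+1; rewrite lead_coefE P_size /= => ->.
    by rewrite subrr.
  by rewrite coefB nth_default ?sXP// nth_default ?P_size// subrr.
(* The system for the [b k] is triangular: under [phi k] the terms below [k] vanish by induction and
   those above by orthogonality, while the shift makes the left side zero as long as [k + r < n]. *)
have b0 k : (k + r < n)%N -> b k = 0.
  elim/ltn_ind: k => k IHk kn.
  have kn1 : (k < n.+1)%N by rewrite ltnS ltnW// (leq_ltn_trans _ kn) ?leq_addr.
  have : phi k ('X * P n - P n.+1) = b k * phi k (P k).
    rewrite bE linear_sum (bigD1 (Ordinal kn1))//= linearZ big1 ?addr0// => i ik.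
    rewrite linearZ /=; have [ltik|ltki|eqik] := ltngtP i k.
    - by rewrite IHk ?mul0r// (leq_ltn_trans _ kn)// leq_add2r ltnW.
    - by rewrite P_orth ?mulr0.
    - by rewrite -val_eqE /= eqik eqxx in ik.
  rewrite linearB /= phi_shift (P_orth kn) (P_orth kn1) subr0 => /esym/eqP.
  by rewrite mulf_eq0 (negPf (step_orthogonal_diag k)) orbF => /eqP.
(* [b] is indexed by degree, the recurrence by the distance from [n]; hence the reversal of the sum.
   Distances above [r] are removed by [b0]. *)
exists (fun j => b (n - j)%N).
rewrite -[LHS](subrK (P n.+1)) addrC bE; congr +%R.
rewrite -(big_mkord xpredT (fun i => b i *: P i)) big_nat_rev /= add0n.
rewrite -(big_mkord xpredT (fun j => b (n - j)%N *: P (n - j)%N)) /=.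
rewrite (@big_cat_nat _ _ _ (minn r n).+1) //=; last by rewrite ltnS geq_minr.
rewrite [X in _ + X]big_nat_cond [X in _ + X]big1 ?addr0; last first.
  move=> i /andP[/andP[mi ini] _]; rewrite subSS b0 ?scale0r//.
  have ni : (i <= n)%N by rewrite -ltnS.
  have ri : (r < i)%N by move: mi; rewrite gtn_min [(n < i)%N]ltnNge ni orbF.
  by rewrite -[ltnRHS](subnK ni) ltn_add2l.
by apply: eq_bigr => i _; rewrite subSS.
Qed.

(** * The recurrence coefficients and the truncated Hessenberg matrix *)

Variable a : nat -> nat -> F.
Hypothesis aP : forall n,
  'X * P n = P n.+1 + \sum_(j < (minn r n).+1) a n j *: P (n - j)%N.

(** The form [phi (n - r)] sends ['X * P n] to the nonzero [phi n (P n)] by the shift; on the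
    recurrence only the term with [a n r] survives it. *)
Lemma extreme_recurrence_coef_neq0 n : (r <= n)%N -> a n r != 0.
Proof.
move=> rn; have := phi_shift (n - r)%N (P n).
rewrite subnK// aP linearD P_orth ?add0r; last by rewrite ltnS leq_subr.
rewrite linear_sum big_ord_recr /= (minn_idPl rn) big1 ?add0r; last first.
  move=> i _; rewrite linearZ /= P_orth ?mulr0//.
  by rewrite ltn_sub2l// (leq_trans (ltn_ord i)).
rewrite linearZ /= => eq_phi; apply/eqP => a0.
by move: (step_orthogonal_diag n); rewrite -eq_phi a0 mul0r eqxx.
Qed.

(** The body of [Lmx] for arbitrary coefficients; for [rec_coef] the two are convertible. *)
Definition hessenberg_mx n : 'M[F]_n :=
  \matrix_(p < n, q < n)
    if q == p.+1 :> nat then 1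
    else if (q <= p)%N && (p - q <= r)%N then a p (p - q)%N else 0.

(** A row of the product is the right side of the recurrence; truncation loses the term [f p.+1] in
    the last row only. *)
Lemma hessenberg_mx_mul n (f : nat -> F) (p : 'I_n) :
  \sum_(q < n) hessenberg_mx n p q * f q =
  (if (p.+1 < n)%N then f p.+1 else 0) +
  \sum_(j < (minn r p).+1) a p j * f (p - j)%N.
Proof.
have pn := ltn_ord p.
transitivity (\sum_(0 <= q < n) (if q == p.+1 then f q else 0) +
  \sum_(0 <= q < n)
    (if (q <= p)%N && (p - q <= r)%N then a p (p - q)%N * f q else 0)).
  rewrite !big_mkord -big_split; apply: eq_bigr => q _ /=; rewrite mxE.
  case: eqP => [->|_]; first by rewrite ltnn /= mul1r addr0.
  by case: ifP => _; rewrite ?mul0r add0r.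
congr +%R.
  rewrite -big_mkcond /=; case: ltnP => pn1.
    rewrite big_mkord (bigD1 (Ordinal pn1))//= big1 ?addr0// => i.
    by case/andP => /eqP ip /eqP[]; apply: val_inj.
  rewrite big_nat_cond big1// => i /andP[/andP[_ ini] /eqP ip].
  by move: ini; rewrite ip ltnNge pn1.
rewrite (@big_cat_nat _ _ _ p.+1) //= [X in _ + X]big_nat_cond.
rewrite [X in _ + X]big1 ?addr0; last first.
  by move=> i /andP[/andP[pi _] _]; rewrite leqNgt pi.
(* The reversal replaces the column by its distance to the diagonal. *)
rewrite big_nat_rev /= add0n.
rewrite (@big_cat_nat _ _ _ (minn r p).+1) //=; last by rewrite ltnS geq_minr.
rewrite [X in _ + X]big_nat_cond [X in _ + X]big1 ?addr0; last first.
  move=> i /andP[/andP[mi ipi] _].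
  have pi : (i <= p)%N by rewrite -ltnS.
  have ri : (r < i)%N by move: mi; rewrite gtn_min [(p < i)%N]ltnNge pi orbF.
  by rewrite subSS subKn// [(i <= r)%N]leqNgt ri andbF.
rewrite big_mkord; apply: eq_bigr => i _; rewrite subSS.
have /andP[ir ip] : (i <= r)%N && (i <= p)%N by rewrite -leq_min -ltnS.
by rewrite subKn// leq_subr ir.
Qed.

Lemma recurrence_horner p z :
  z * (P p).[z] =
  (P p.+1).[z] + \sum_(j < (minn r p).+1) a p j * (P (p - j)%N).[z].
Proof.
have := congr1 (horner^~ z) (aP p); rewrite hornerM hornerX => ->.
rewrite hornerD horner_sum; congr +%R.
by apply: eq_bigr => j _; rewrite hornerZ.
Qed.

Definition P_col n z : 'cV[F]_n := \col_(i < n) (P i).[z].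

Lemma P0_horner z : (P 0).[z] = 1.
Proof.
have /size_poly1P[c _ Pc] : size (P 0) == 1%N by rewrite P_size.
by have := P_monic 0; rewrite monicE Pc lead_coefC hornerC => /eqP.
Qed.

Lemma hessenberg_mx_col n z : root (P n) z ->
  hessenberg_mx n *m P_col n z = z *: P_col n z.
Proof.
move=> /rootP Pz; apply/colP => p; rewrite !mxE recurrence_horner.
rewrite -[RHS]/(_ + _); under eq_bigr do rewrite [P_col _ _ _ _]mxE.
rewrite (hessenberg_mx_mul (fun q => (P q).[z])); congr +%R; case: ltnP => // np.
by have -> : p.+1 = n by apply/eqP; rewrite eqn_leq np ltn_ord.
Qed.

(** Each row of the eigenvalue equation determines the next component from the earlier ones, so [v]
    follows the recurrence from its first component; the last row constrains [z]. *)
Lemma right_eigenvector_P_col n (hn : (0 < n)%N) z (v : 'cV[F]_n) :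
  hessenberg_mx n *m v = z *: v ->
  v = v (Ordinal hn) 0 *: P_col n z /\ v (Ordinal hn) 0 * (P n).[z] = 0.
Proof.
move=> Lv; set v0 := v _ _.
(* Extended by zero, [v] satisfies the recurrence in the last row too; index [n] then yields the
   second claim. *)
pose f i := if insub i is Some j then v j 0 else 0 : F.
have fE (i : 'I_n) : f i = v i 0 by rewrite /f valK.
have fn i : (n <= i)%N -> f i = 0 by move=> ni; rewrite /f insubN// -leqNgt.
have fS p : (p < n)%N ->
    z * f p = f p.+1 + \sum_(j < (minn r p).+1) a p j * f (p - j)%N.
  move=> pn; rewrite (fE (Ordinal pn)).
  have /colP/(_ (Ordinal pn)) := Lv; rewrite !mxE => <-.
  under eq_bigr do rewrite -fE.
  rewrite hessenberg_mx_mul /=; congr +%R.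
  by case: ltnP => // /fn.
have fP p : (p <= n)%N -> f p = v0 * (P p).[z].
  elim/ltn_ind: p => -[_ _|p IHp pn].
    by rewrite P0_horner mulr1 (fE (Ordinal hn)).
  apply: (@addIr _ (\sum_(j < (minn r p).+1) a p j * f (p - j)%N)).
  rewrite -(fS p pn) (IHp p (ltnSn p) (ltnW pn)) mulrCA recurrence_horner mulrDr.
  congr +%R.
  rewrite mulr_sumr; apply: eq_bigr => j _.
  rewrite IHp ?ltnS ?leq_subr// 1?mulrCA//.
  by rewrite (leq_trans (leq_subr _ _))// ltnW.
split; last by rewrite -fP ?fn.
by apply/colP => i; rewrite !mxE -fE fP// ltnW.
Qed.

(** * Spectrum and left eigenvectors of the Hessenberg matrix *)

Section Spectrum.
Variables (n : nat) (hn : (0 < n)%N) (x : 'I_n -> F).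
Hypotheses (x_inj : injective x) (PnE : P n = \prod_(l < n) ('X - (x l)%:P)).

Let H := hessenberg_mx n.

Lemma root_P_node z : reflect (exists l, z = x l) (root (P n) z).
Proof.
rewrite PnE -(big_map x xpredT (fun y => 'X - y%:P)) root_prod_XsubC.
by apply: (iffP mapP) => [[l _ ->]|[l ->]]; exists l; rewrite ?mem_index_enum.
Qed.

Lemma hessenberg_mx_node l : H *m P_col n (x l) = x l *: P_col n (x l).
Proof. by apply: hessenberg_mx_col; apply/root_P_node; exists l. Qed.

Lemma eigenvalue_hessenberg z : eigenvalue H z <-> exists l, z = x l.
Proof.
rewrite -eigenvalue_trmx; split=> [/eigenvalueP[w wH w0]|[l ->]].
  have Hw : H *m w^T = z *: w^T.
    by apply: trmx_inj; rewrite trmx_mul !linearZ /= trmxK.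
  (* A zero first component would make [w] zero, so [z] is a root of [P n]. *)
  have [wE /eqP] := right_eigenvector_P_col hn Hw.
  rewrite mulf_eq0 => /orP[/eqP w00|]; last by move/root_P_node.
  move: w0; suff -> : w = 0 by rewrite eqxx.
  by apply: trmx_inj; rewrite wE w00 scale0r trmx0.
apply/eigenvalueP; exists (P_col n (x l))^T.
  by rewrite -trmx_mul hessenberg_mx_node linearZ.
apply/eqP => /rowP/(_ (Ordinal hn))/eqP.
by rewrite !mxE P0_horner oner_eq0.
Qed.

(* Left and right eigenvectors for distinct eigenvalues are orthogonal. *)
Lemma left_eigenvector_lagrange (u : 'cV[F]_n) l : u^T *m H = x l *: u^T ->
  \sum_(i < n) u i 0 *: P i =
  (u^T *m P_col n (x l)) 0 0 *: lagrange_poly x l.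
Proof.
move=> uH; apply: (poly_eq_on_nodes x_inj).
- exact: size_monic_basis_sum.
- by rewrite (leq_trans (size_scale_leq _ _)) ?size_lagrange_poly.
move=> m; rewrite hornerZ lagrange_poly_node// horner_sum.
have -> : \sum_(i < n) (u i 0 *: P i).[x m] = (u^T *m P_col n (x m)) 0 0.
  by rewrite mxE; apply: eq_bigr => i _; rewrite hornerZ !mxE.
have [->|ml] := eqVneq m l; first by rewrite mulr1.
rewrite mulr0; have : x l *: (u^T *m P_col n (x m)) =
    x m *: (u^T *m P_col n (x m)).
  by rewrite scalemxAl -uH -mulmxA hessenberg_mx_node scalemxAr.
move/eqP; rewrite -subr_eq0 -scalerBl scaler_eq0 subr_eq0 (inj_eq x_inj).
by rewrite eq_sym (negPf ml) => /eqP ->; rewrite mxE.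
Qed.

(** Otherwise the combination of the [P i] with coefficients [u] would be zero, against linear
    independence. *)
Lemma left_right_eigenvector_neq0 (u : 'cV[F]_n) l : u != 0 ->
  u^T *m H = x l *: u^T -> (u^T *m P_col n (x l)) 0 0 != 0.
Proof.
move=> u0 /left_eigenvector_lagrange uP; apply: contraNneq u0 => uv0.
move: uP; rewrite uv0 scale0r => /(monic_basis_free P_monic P_size) ui.
by apply/eqP/colP => i; rewrite ui mxE.
Qed.

(** Both vectors give multiples of the same Lagrange polynomial, and the [P i] are linearly
    independent. *)
Lemma left_eigenvector_proportional (u u' : 'cV[F]_n) l : u != 0 ->
  u^T *m H = x l *: u^T -> u'^T *m H = x l *: u'^T ->
  exists c, u' = c *: u.
Proof.
move=> u0 uH u'H; set c := (u^T *m P_col n (x l)) 0 0.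
set c' := (u'^T *m P_col n (x l)) 0 0; exists (c' / c).
have c0 : c != 0 by exact: left_right_eigenvector_neq0.
apply/colP => i; rewrite mxE; apply/eqP; rewrite -subr_eq0; apply/eqP.
apply: (monic_basis_free P_monic P_size
  (b := fun i => u' i 0 - c' / c * u i 0)).
under eq_bigr do rewrite scalerBl -scalerA.
rewrite big_split /= sumrN -scaler_sumr.
rewrite (left_eigenvector_lagrange uH) (left_eigenvector_lagrange u'H).
by rewrite scalerA divfK// subrr.
Qed.

Lemma left_eigenvector_first_index (u : 'cV[F]_n) z (k : 'I_n) : (0 < r)%N ->
  u^T *m H = z *: u^T -> u k 0 != 0 ->
  (forall i : 'I_n, (i < k)%N -> u i 0 = 0) -> (k < r)%N.
Proof.
move=> r0 uH uk0 u0; rewrite ltnNge; apply/negP => rk.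
have krn : (k - r < n)%N by rewrite (leq_ltn_trans (leq_subr _ _)).
have krk : (k - r < k)%N by rewrite ltn_subrL r0 (leq_trans r0).
(* In column [k - r] only row [k] contributes: [u] vanishes above it, and the rows below it lie
   outside the band. The right side is zero since [k - r < k]. *)
have /rowP/(_ (Ordinal krn)) := uH.
rewrite !mxE (u0 (Ordinal krn))// mulr0 (bigD1 k)//= big1 ?addr0 => [|i ik].
  rewrite !mxE /= ltn_eqF ?(ltn_trans krk)// leq_subr subKn// leqnn /=.
  move/eqP; rewrite mulf_eq0 (negPf uk0).
  by rewrite (negPf (extreme_recurrence_coef_neq0 rk)).
rewrite !mxE; have [ltik|ltki|eqik] := ltngtP i k.
- by rewrite u0 ?mul0r.
- rewrite /= ltn_eqF; last by rewrite ltnS ltnW// (ltn_trans krk).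
  have -> : (i - (k - r) <= r)%N = false.
    by apply/negbTE; rewrite -ltnNge ltn_subRL subnK.
  by rewrite andbF mulr0.
- by rewrite -val_eqE /= eqik eqxx in ik.
Qed.

End Spectrum.

End StepLine.

(** * Linearity of the integral against a complex measure *)

Section ChargeIntegralLinear.
Context d (T : measurableType d) (R : realType).
Variables (nu : {charge set T -> \bar R}) (D : set T).
Hypothesis mD : measurable D.
Implicit Types f g : T -> R.

Lemma charge_integrable_lin a b f g :
  charge_integrable nu D f -> charge_integrable nu D g ->
  charge_integrable nu D (fun x => a * f x + b * g x).
Proof.
move=> [fp fn] [gp gn]; split.
- have := integrableD mD (integrableZl mD a fp) (integrableZl mD b gp).
  exact: eq_integrable.
- have := integrableD mD (integrableZl mD a fn) (integrableZl mD b gn).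
  exact: eq_integrable.
Qed.

Lemma charge_integral_lin a b f g :
  charge_integrable nu D f -> charge_integrable nu D g ->
  charge_integral nu D (fun x => a * f x + b * g x) =
  a * charge_integral nu D f + b * charge_integral nu D g.
Proof.
move=> [fp fn] [gp gn].
have lin (m : {measure set T -> \bar R}) :
    m.-integrable D (EFin \o f) -> m.-integrable D (EFin \o g) ->
    Rintegral m D (fun x => a * f x + b * g x) =
    a * Rintegral m D f + b * Rintegral m D g.
  move=> fi gi.
  have afi : m.-integrable D (EFin \o (fun x => a * f x)).
    by apply: eq_integrable (integrableZl mD a fi).
  have bgi : m.-integrable D (EFin \o (fun x => b * g x)).
    by apply: eq_integrable (integrableZl mD b gi).
  by rewrite RintegralD// !RintegralZl.
rewrite /charge_integral !lin//.
by rewrite !mulrBr opprD addrACA.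
Qed.

End ChargeIntegralLinear.

Section ComplexIntegralLinear.
Variables (R : realType) (mu : complex_measure R).
Implicit Types f g : R[i] -> R[i].

(** The complement is open: a neighbourhood [U] showing that one point lies outside does so for all
    its points. *)
Lemma measurable_csupport : measurable (csupport mu).
Proof.
rewrite -[csupport mu]setCK; apply: measurableC; apply: sub_sigma_algebra.
rewrite openE => z /= /existsNP[U /not_implyP[oU /not_implyP[Uz nA]]].
rewrite /interior/= nbhsE/=; exists U; first by split.
by move=> w Uw /(_ U oU Uw).
Qed.

(* The factors 1 give the right-hand sides the shape of [charge_integral_lin]. *)
Lemma Re_lin (c z w : R[i]) : complex.Re (c * z + w) =
  1 * (complex.Re c * complex.Re z + - complex.Im c * complex.Im z) +
  1 * complex.Re w.
Proof. by case: c z w => [? ?] [? ?] [? ?] /=; rewrite !mul1r mulNr. Qed.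

Lemma Im_lin (c z w : R[i]) : complex.Im (c * z + w) =
  1 * (complex.Re c * complex.Im z + complex.Im c * complex.Re z) +
  1 * complex.Im w.
Proof. by case: c z w => [? ?] [? ?] [? ?] /=; rewrite !mul1r. Qed.

Lemma cintegrable_lin c f g : cintegrable mu f -> cintegrable mu g ->
  cintegrable mu (fun z => c * f z + g z).
Proof.
have mS := measurable_csupport; move=> [? ? ? ?] [? ? ? ?]; split.
all: by under eq_fun do rewrite (Re_lin, Im_lin);
  do 2![apply: charge_integrable_lin => //].
Qed.

Lemma cintegral_lin c f g : cintegrable mu f -> cintegrable mu g ->
  cintegral mu (fun z => c * f z + g z) = c * cintegral mu f + cintegral mu g.
Proof.
have mS := measurable_csupport; move=> [? ? ? ?] [? ? ? ?].
rewrite /cintegral.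
have -> : (fun z => complex.Re (c * f z + g z)) = (fun z =>
  1 * (complex.Re c * complex.Re (f z) + - complex.Im c * complex.Im (f z)) +
  1 * complex.Re (g z)) by apply/funext => z; exact: Re_lin.
have -> : (fun z => complex.Im (c * f z + g z)) = (fun z =>
  1 * (complex.Re c * complex.Im (f z) + complex.Im c * complex.Re (f z)) +
  1 * complex.Im (g z)) by apply/funext => z; exact: Im_lin.
rewrite !charge_integral_lin//; do ?exact: charge_integrable_lin.
(* With the real integrals generalized to variables, each component is a ring identity. *)
rewrite !mul1r; repeat match goal with
  |- context [charge_integral ?m ?D ?h] => move: (charge_integral m D h) => ?
end.
case: c => a b; apply/eqP; rewrite eq_complex /=.
by apply/andP; split; apply/eqP; ring.
Qed.

(* The proof that the moments exist is an argument because the canonical linear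
   structure below depends on it. *)
Definition moment_form of all_moments_exist mu := fun p : {poly R[i]} =>
  cintegral mu (horner p).

Hypothesis hmom : all_moments_exist mu.

Lemma cintegrable_horner (p : {poly R[i]}) : cintegrable mu (horner p).
Proof.
(* This is the base case of the induction; zero is obtained from monomials as
   [-1 * z ^+ 0 + z ^+ 0]. *)
have cint0 : cintegrable mu (fun=> 0).
  have := cintegrable_lin (-1) (hmom 0) (hmom 0).
  by under eq_fun do rewrite mulN1r addNr.
have -> : horner p = fun z => \sum_(i < size p) p`_i * z ^+ i.
  by apply/funext => z; rewrite horner_coef.
elim: (size p) => [|n IHn]; first by under eq_fun do rewrite big_ord0.
under eq_fun do rewrite big_ord_recr /= addrC.
exact: cintegrable_lin.
Qed.

Lemma moment_form_is_linear : scalar (moment_form hmom).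
Proof.
move=> c p q; rewrite /moment_form -cintegral_lin; try exact: cintegrable_horner.
by congr cintegral; apply/funext => z; rewrite hornerD hornerZ.
Qed.

HB.instance Definition _ :=
  GRing.isLinear.Build R[i] {poly R[i]} R[i] *%R (moment_form hmom)
    moment_form_is_linear.

End ComplexIntegralLinear.

(** * Moment matrices and Cramer's rule *)

Section MomentMatrix.
Variables (R : realType) (r : nat) (hr : (0 < r)%N).
Variable mu : 'I_r -> complex_measure R.

Lemma nu_below_diag k j : (k <= r)%N -> nu r k j = (j < k)%N.
Proof.
by case: k => // k kr; rewrite /= divn_small// modn_small// add0n.
Qed.

(** While [k <= r], each of the first [k] measures contributes a block of one column and the others
    none. *)
Lemma DmxE k (kr : (k <= r)%N) (i p : 'I_k) :
  Dmx mu hr k i p = moment (mu (widen_ord kr i)) p.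
Proof.
rewrite /Dmx mxE castmxE /mxrow !mxE.
set s := cast_ord _ i.
(* The index is the total size of the earlier blocks plus the offset in its own block; here these
   are the block number and zero. *)
have sE := tagnat.rect s.
have := ltn_ord (tagnat.sig2 s); rewrite {2}nu_below_diag// => s2.
have s1k : (tagnat.sig1 s < k)%N by move: s2; case: (_ < k)%N.
have s20 : tagnat.sig2 s = 0%N :> nat.
  by apply/eqP; rewrite -leqn0 -ltnS (leq_trans s2)// leq_b1.
have s1 : tagnat.sig1 s = i :> nat.
  rewrite (_ : nat_of_ord i = s)// sE s20 addn0.
  rewrite (eq_bigr (fun=> 1%N)) => [|j js]; last first.
    by rewrite nu_below_diag// (ltn_trans js).
  rewrite -(big_ord_widen _ (fun=> 1%N)) ?sum1_card ?card_ord//.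
  exact: ltnW.
rewrite s20 addn0; congr (moment (mu _) _).
exact: val_inj.
Qed.

End MomentMatrix.

Section CramerLastRow.
Variables (F : fieldType) (k : nat) (M : 'M[F]_k.+1) (c : 'cV[F]_k.+1).
Variable e : F.
Hypotheses (Mc : M *m c = e *: delta_mx ord_max 0) (c_max : c ord_max 0 = 1).

(** The adjugate turns the left side of [Mc] into [\det M *: c] and the right side into a multiple
    of one column of cofactors. *)
Lemma cramer_last_row i : c i 0 * \det M = e * cofactor M ord_max i.
Proof.
have := congr1 (mulmx (\adj M)) Mc.
rewrite mulmxA mul_adj_mx mul_scalar_mx -scalemxAr => /colP/(_ i).
rewrite !mxE (bigD1 ord_max)//= big1 => [|j jm]; last first.
  by rewrite !mxE (negPf jm) mulr0.
by rewrite !mxE !eqxx mulr1 addr0 mulrC.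
Qed.

Lemma cramer_last_row_det : \det M = e * \det (row' ord_max (col' ord_max M)).
Proof.
have := cramer_last_row ord_max; rewrite c_max mul1r => ->.
by rewrite /cofactor -signr_odd oddD addbb mul1r.
Qed.

Lemma cramer_last_row_coef i :
  e != 0 -> \det (row' ord_max (col' ord_max M)) != 0 ->
  c i 0 = (-1) ^+ (k + i) *
    (\det (row' ord_max (col' i M)) / \det (row' ord_max (col' ord_max M))).
Proof.
move=> e0 d0; have := cramer_last_row i.
rewrite cramer_last_row_det mulrCA => /(mulfI e0) ci.
by rewrite -[LHS](mulfK d0) ci /cofactor mulrA.
Qed.

End CramerLastRow.

(** * The step-line of a weakly complete system *)

(** This translates the multi-index into the step-line order. For positive [n], [l] is compared with
    the quotient of [n - 1] by [r]; the remainder decides only in case of equality. *)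
Lemma ltn_nu r n l j : (j < r)%N -> (l < nu r n j)%N = (l * r + j < n)%N.
Proof.
case: n => // n jr /=; have r0 : (0 < r)%N by exact: leq_ltn_trans jr.
rewrite [in RHS](divn_eq n r); have := ltn_pmod n r0.
move: (n %/ r)%N (n %% r)%N => q s sr.
have [lq|ql|->] := ltngtP l q.
- rewrite ltn_addr// ltnS ltnW//.
  apply: (@leq_trans (q * r)%N); last exact: leq_addr.
  by rewrite (leq_trans _ (leq_mul lq (leqnn r)))// mulSn addnC ltn_add2r.
- have -> : (l < q + (j <= s))%N = false.
    by apply/negbTE; rewrite -leqNgt (leq_trans _ ql)// -addn1 leq_add2l leq_b1.
  apply/esym/negbTE; rewrite -leqNgt; apply: leq_trans (leq_addr _ _).
  by rewrite (leq_trans _ (leq_mul ql (leqnn r)))// mulSn addnC ltn_add2r.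
- by rewrite ltnS leq_add2l -[ltnLHS]addn0 ltn_add2l; case: (j <= s)%N.
Qed.

Section StepForm.
Variables (R : realType) (r : nat) (hr : (0 < r)%N).
Variables (mu : 'I_r -> complex_measure R).
Hypothesis hmom : forall j, all_moments_exist (mu j).

(* The multi-index of [n] imposes exactly the first [n] of these conditions. *)
Definition step_form k (p : {poly R[i]}) : R[i] :=
  moment_form (hmom (Ordinal (ltn_pmod k hr))) (p * 'X^(k %/ r)).

Lemma step_form_is_linear k : scalar (step_form k).
Proof.
by move=> c p q; rewrite /step_form mulrDl -scalerAl linearD linearZ.
Qed.

HB.instance Definition _ k :=
  GRing.isLinear.Build R[i] {poly R[i]} R[i] *%R (step_form k)
    (step_form_is_linear k).

Let phi k : {scalar {poly R[i]}} := step_form k.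

Lemma step_formE (j : 'I_r) l p :
  step_form (l * r + j) p = cintegral (mu j) (fun z => p.[z] * z ^+ l).
Proof.
rewrite /step_form /moment_form divnMDl// divn_small// addn0.
have -> : Ordinal (ltn_pmod (l * r + j) hr) = j.
  by apply: val_inj; rewrite /= modnMDl modn_small.
by congr cintegral; apply/funext => z; rewrite hornerM hornerXn.
Qed.

Lemma step_form_ord (j : 'I_r) p : step_form j p = moment_form (hmom j) p.
Proof.
rewrite -[nat_of_ord j in LHS]add0n -(mul0n r) step_formE.
by congr cintegral; apply/funext => z; rewrite expr0 mulr1.
Qed.

(** Adding [r] to the index keeps the measure and raises the power of [z] by one. *)
Lemma step_form_shift k p : phi k ('X * p) = phi (k + r)%N p.
Proof.
have stepE l := step_formE (Ordinal (ltn_pmod k hr)) l.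
rewrite (divn_eq k r) addnAC -mulSnr /phi /= !stepE; congr cintegral.
apply/funext => z.
by rewrite hornerM hornerX exprS [RHS]mulrCA mulrA.
Qed.

Lemma typeII_step n p : typeII mu n p <->
  [/\ p != 0, (size p <= n.+1)%N & step_orthogonal phi n p].
Proof.
split=> -[p0 sp op]; split=> //.
- move=> k; rewrite (divn_eq k r).
  have stepE l := step_formE (Ordinal (ltn_pmod k hr)) l.
  by rewrite -ltn_nu ?ltn_pmod// => kn; rewrite /phi /= stepE;
    exact: (op (Ordinal (ltn_pmod k hr))) kn.
- by move=> j l; rewrite ltn_nu// -step_formE; exact: op.
Qed.

Lemma moment_form_coef (j : 'I_r) m (p : {poly R[i]}) : (size p <= m)%N ->
  moment_form (hmom j) p = \sum_(i < m) p`_i * moment (mu j) i.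
Proof.
move=> sp; have -> : p = \sum_(i < m) p`_i *: 'X^i.
  rewrite -poly_def; apply/polyP => i; rewrite coef_poly.
  by case: ltnP => // /(leq_trans sp) /(nth_default 0).
rewrite linear_sum; apply: eq_bigr => i _; rewrite linearZ /=.
rewrite -poly_def coef_poly ltn_ord; congr (_ * cintegral _ _).
by apply/funext => z; rewrite hornerXn.
Qed.

Hypothesis hwc : weakly_complete mu.

(** Weak completeness covers positive [n]; for [n = 0] a nonzero polynomial of size at most one has
    size one. *)
Lemma step_form_normal n (p : {poly R[i]}) :
  p != 0 -> (size p <= n.+1)%N -> step_orthogonal phi n p -> size p = n.+1.
Proof.
move=> p0 sp op; have [n0|n0] := posnP n; last exact/hwc/typeII_step.
by apply/eqP; rewrite eqn_leq sp n0 size_poly_gt0.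
Qed.

(** Existence ensures that the [xget] in [Ppoly] returns a solution and not the default value. *)
Lemma Ppoly_spec n : typeII mu n (Ppoly mu n) /\ Ppoly mu n \is monic.
Proof.
apply: (@xgetPex _ 0 [set p | typeII mu n p /\ p \is monic]).
have [p [pm sp op]] := monic_step_orthogonal_exists step_form_normal n.
by exists p; split=> //; apply/typeII_step; rewrite monic_neq0// sp.
Qed.

Lemma Ppoly_monic n : Ppoly mu n \is monic.
Proof. by have [] := Ppoly_spec n. Qed.

Lemma Ppoly_orth n : step_orthogonal phi n (Ppoly mu n).
Proof. by have [/typeII_step[]] := Ppoly_spec n. Qed.

Lemma size_Ppoly n : size (Ppoly mu n) = n.+1.
Proof.
by have [/typeII_step[p0 sp op] _] := Ppoly_spec n; exact: step_form_normal.
Qed.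

Lemma rec_coefP n : 'X * Ppoly mu n =
  Ppoly mu n.+1 + \sum_(j < (minn r n).+1) rec_coef mu n j *: Ppoly mu (n - j).
Proof.
have := step_recurrence step_form_shift step_form_normal Ppoly_monic size_Ppoly
  Ppoly_orth n.
exact: (@xgetPex _ (fun=> 0) [set a : nat -> R[i] | 'X * Ppoly mu n =
  Ppoly mu n.+1 + \sum_(j < (minn r n).+1) a j *: Ppoly mu (n - j)]).
Qed.

Lemma CconstE j k : Cconst mu j k = phi j (Ppoly mu k).
Proof. by rewrite /phi /= step_form_ord. Qed.

Lemma Cconst_gt (j : 'I_r) k : (j < k)%N -> Cconst mu j k = 0.
Proof. by move=> jk; rewrite CconstE Ppoly_orth. Qed.

Lemma Cconst_diag_neq0 (j : 'I_r) : Cconst mu j j != 0.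
Proof.
rewrite CconstE.
exact: (step_orthogonal_diag step_form_normal Ppoly_monic size_Ppoly Ppoly_orth).
Qed.

(** Below [r], passing from [k] to [k.+1] adds one row, from a new measure, and one column, of
    moments of the next order. *)
Lemma Dmx_minor k : (k < r)%N ->
  row' ord_max (col' ord_max (Dmx mu hr k.+1)) = Dmx mu hr k.
Proof.
move=> kr; apply/matrixP => i p; rewrite [LHS]mxE [LHS]mxE.
rewrite (DmxE _ _ kr) (DmxE _ _ (ltnW kr)) lift_max; congr (moment (mu _) _).
by apply: val_inj; rewrite /= -[RHS](lift_max i).
Qed.

Definition Ppoly_coef_col k : 'cV[R[i]]_k.+1 := \col_(i < k.+1) (Ppoly mu k)`_i.

(** Row [i] of the product is [phi i (Ppoly mu k)], so this is orthogonality in matrix form, ready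
    for Cramer's rule. *)
Lemma Dmx_Ppoly_coef (k : 'I_r) : Dmx mu hr k.+1 *m Ppoly_coef_col k =
  Cconst mu k k *: delta_mx ord_max 0.
Proof.
apply/colP => i; rewrite [LHS]mxE [RHS]mxE [X in _ * X]mxE andbT.
under eq_bigr do rewrite [X in _ * X]mxE (DmxE _ _ (ltn_ord k)) mulrC.
rewrite -moment_form_coef ?size_Ppoly//.
have [->|ik] := eqVneq i ord_max.
  rewrite mulr1 CconstE /phi /= step_form_ord; congr (moment_form (hmom _) _).
  exact: val_inj.
rewrite mulr0 -step_form_ord (Ppoly_orth (n := k))//.
by rewrite /= ltn_neqAle ik -ltnS /=.
Qed.

Lemma Ppoly_coef_max k : Ppoly_coef_col k ord_max 0 = 1.
Proof.
by have /monicP := Ppoly_monic k; rewrite lead_coefE size_Ppoly mxE.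
Qed.

(** By Cramer's rule each determinant is the previous one times a nonzero diagonal constant. *)
Lemma det_Dmx_neq0 k : (k <= r)%N -> \det (Dmx mu hr k) != 0.
Proof.
elim: k => [|k IHk] kr; first by rewrite det_mx00 oner_eq0.
have := cramer_last_row_det (Dmx_Ppoly_coef (Ordinal kr)) (Ppoly_coef_max k).
move=> ->; rewrite mulf_neq0//; first exact: Cconst_diag_neq0.
by rewrite (Dmx_minor kr) IHk// ltnW.
Qed.

(** Cramer's rule gives the coefficients of [Ppoly mu k], which are paired with the moments.
    Counting from zero shifts [k] and [i] alike, so the sign agrees with the one-based formula. *)
Lemma Cconst_minors (j : 'I_r) k : (k < r)%N -> Cconst mu j k =
  \sum_(i < k.+1) (-1) ^+ (k + i) * moment (mu j) i *
    (\det (row' ord_max (col' i (Dmx mu hr k.+1))) / \det (Dmx mu hr k)).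
Proof.
move=> kr; rewrite CconstE /phi /= step_form_ord.
rewrite (moment_form_coef _ (m := k.+1)) ?size_Ppoly//.
apply: eq_bigr => i _.
have := cramer_last_row_coef (Dmx_Ppoly_coef (Ordinal kr)) (Ppoly_coef_max k)
  i (Cconst_diag_neq0 (Ordinal kr)).
rewrite (Dmx_minor kr) mxE => ->; last by rewrite det_Dmx_neq0// ltnW.
by rewrite mulrAC.
Qed.

End StepForm.

(** * Normalized left eigenvectors and the quadrature weights *)

Lemma left_eigenvector_exists (F : fieldType) n (L : 'M[F]_n) z :
  eigenvalue L z -> exists u k, left_eigenvector L z u k.
Proof.
move=> /eigenvalueP[w wL w0].
have [i0 wi0] : exists i, w 0 i != 0.
  by apply/existsP; apply: contraNT w0 => /existsPn w0; apply/eqP/rowP => i;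
    rewrite mxE; apply/eqP; rewrite -[_ == _]negbK.
have [k wk kmin] := arg_minnP (P := fun i => w 0 i != 0) (@nat_of_ord n) wi0.
exists ((w 0 k)^-1 *: w^T), k; split.
- by rewrite linearZ /= trmxK -scalemxAl wL !scalerA mulrC.
- by rewrite !mxE mulVf.
- move=> i ik; rewrite !mxE; apply/eqP; rewrite mulf_eq0 orbC -[w 0 i == 0]negbK.
  by apply/orP; left; apply/negP => /kmin; rewrite leqNgt ik.
Qed.

Lemma left_eigenvector_neq0 (F : fieldType) n (L : 'M[F]_n) z u k :
  left_eigenvector L z u k -> u != 0.
Proof.
by case=> _ uk _; apply: contra_eq_neq uk => ->; rewrite mxE eq_sym oner_eq0.
Qed.

Theorem theorem3p2 (R : realType) (r : nat) (hr : (0 < r)%N)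
    (mu : 'I_r -> complex_measure R)
    (hmom : forall j : 'I_r, all_moments_exist (mu j))
    (hwc : weakly_complete mu)
    (n : nat) (hn : (0 < n)%N) (x : 'I_n -> R[i])
    (hx : injective x)
    (hP : Ppoly mu n = \prod_(l < n) ('X - (x l)%:P)) :
  [/\ forall z : R[i], eigenvalue (Lmx mu n) z <-> exists l : 'I_n, z = x l,
      forall l : 'I_n,
        (exists! v : 'cV[R[i]]_n, right_eigenvector hn (Lmx mu n) (x l) v) /\
        (exists! u : 'cV[R[i]]_n,
           exists k : 'I_n, left_eigenvector (Lmx mu n) (x l) u k),
      forall (v u : 'I_n -> 'cV[R[i]]_n) (k : 'I_n -> 'I_n),
        (forall l, right_eigenvector hn (Lmx mu n) (x l) (v l)) ->
        (forall l, left_eigenvector (Lmx mu n) (x l) (u l) (k l)) ->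
        forall l : 'I_n,
          [/\ (k l < minn r n)%N,
              ((u l)^T *m v l) ord0 ord0 != 0,
              forall j : 'I_r,
                weight mu x j l =
                (((u l)^T *m v l) ord0 ord0)^-1 *
                \sum_(i < n | (i <= j)%N) Cconst mu j i * u l i ord0 &
              forall j : 'I_r, (j < k l)%N -> weight mu x j l = 0],
      forall (j : 'I_r) (k : nat), (k <= j)%N ->
        \det (Dmx mu hr k) != 0 /\
        Cconst mu j k =
        \sum_(i < k.+1) (-1) ^+ (k + i) * moment (mu j) i *
          (\det (row' ord_max (col' i (Dmx mu hr k.+1))) /
           \det (Dmx mu hr k)) &
      forall j : 'I_r, Cconst mu j j != 0].
Proof.
have normal := step_form_normal (hr := hr) (hmom := hmom) hwc.
have shift := step_form_shift hr hmom.
have Pm := Ppoly_monic hr hmom hwc.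
have Ps := size_Ppoly hr hmom hwc.
have Po := Ppoly_orth hr hmom hwc.
have aP := rec_coefP hr hmom hwc.
have eigL z : eigenvalue (Lmx mu n) z <-> exists l, z = x l.
  exact: (eigenvalue_hessenberg Pm Ps aP hn hP).
have rightE l v : right_eigenvector hn (Lmx mu n) (x l) v ->
    v = P_col (Ppoly mu) n (x l).
  move=> [Lv v0]; have [-> _] := right_eigenvector_P_col Pm Ps aP hn Lv.
  by rewrite v0 scale1r.
split.
- exact: eigL.
- move=> l; split.
    exists (P_col (Ppoly mu) n (x l)); split; last by move=> v /rightE.
    split; first exact: (hessenberg_mx_node aP hP).
    by rewrite mxE P0_horner.
  have [u [k uk]] := left_eigenvector_exists ((eigL (x l)).2 (ex_intro _ l erefl)).
  exists u; split; first by exists k.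
  move=> u' [k' uk']; have [uL u1 u0] := uk; have [u'L u'1 u'0] := uk'.
  have [c u'E] := left_eigenvector_proportional Pm Ps aP hx hP
    (left_eigenvector_neq0 uk) uL u'L.
  have c0 : c != 0.
    by apply: contraNneq (left_eigenvector_neq0 uk') => c0; rewrite u'E c0 scale0r.
  (* Proportional vectors have the same first nonzero index, so the two normalizations force
     [c = 1]. *)
  have kk' : k = k'.
    have [lkk'|lk'k|/val_inj//] := ltngtP k k'.
      have /eqP := u'0 _ lkk'; rewrite u'E mxE u1 mulr1.
      by rewrite (negPf c0).
    by have /eqP := u'1; rewrite u'E mxE u0// mulr0 eq_sym oner_eq0.
  by move: u'1; rewrite -kk' u'E mxE u1 mulr1 => ->; rewrite scale1r.
- move=> v u k vP uP l; have [uL u1 u0] := uP l.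
  rewrite (rightE _ _ (vP l)).
  have uv0 := left_right_eigenvector_neq0 Pm Ps aP hx hP
    (left_eigenvector_neq0 (uP l)) uL.
  have weightE j : weight mu x j l =
      (((u l)^T *m P_col (Ppoly mu) n (x l)) 0 0)^-1 *
      \sum_(i < n | (i <= j)%N) Cconst mu j i * u l i 0.
    have -> : weight mu x j l = moment_form (hmom j) (lagrange_poly x l).
      by congr cintegral; apply/funext => z; rewrite lagrange_polyE.
    (* Multiplied by the nonzero product, the Lagrange polynomial becomes the combination of the
       [Ppoly mu i] with coefficients [u l]. The form acts termwise, and the terms with [i > j]
       vanish by orthogonality. *)
    apply: (mulfI uv0); rewrite mulVKf// -[LHS]linearZ /=.
    rewrite -(left_eigenvector_lagrange Ps aP hx hP uL) linear_sum.
    rewrite (bigID (fun i : 'I_n => (i <= j)%N)) /= [X in _ + X]big1 ?addr0.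
      by apply: eq_bigr => i _; rewrite linearZ mulrC.
    move=> i; rewrite -ltnNge => ji; rewrite linearZ /=.
    by rewrite [moment_form _ _](Cconst_gt hr hmom hwc ji) mulr0.
  split=> //.
  + rewrite leq_min ltn_ord andbT.
    apply: (left_eigenvector_first_index shift normal Pm Ps Po aP hr uL _ u0).
    by rewrite u1 oner_eq0.
  (* Every index in the sum is at most [j], hence below [k l], where [u l] vanishes. *)
  + move=> j jk; rewrite weightE big1 ?mulr0// => i ij.
    by rewrite u0 ?mulr0// (leq_ltn_trans ij).
- move=> j k kj; have kr := leq_ltn_trans kj (ltn_ord j).
  by rewrite (det_Dmx_neq0 hr hmom hwc) 1?ltnW// -Cconst_minors.
- by move=> j; exact: (Cconst_diag_neq0 hr hmom hwc).
Qed.
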